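(* Let $a$ and $n$ be positive integers with $n\ge 2$. Then the equation $ax+y=z^n$ is 2-Ramsey.
   Context: For $k\in\mathbb{Z}^+$, an equation in the variables $x,y,z$ is called $k$-Ramsey if every colouring of the positive integers $\mathbb{Z}^+$ with $k$ colours admits infinitely many monochromatic solutions $(x,y,z)\in(\mathbb{Z}^+)^3$, i.e. solutions with $x,y,z$ all receiving the same colour. *)

(* Defs.v *)
From mathcomp Require Import all_boot.
From mathcomp Require Import boolp classical_sets cardinality.

Set Implicit Arguments.
Unset Strict Implicit.
Unset Printing Implicit Defensive.

Local Open Scope classical_set_scope.

(* A colouring of the positive integers is given by a map on all of nat, whose
   value at 0 is irrelevant because only positive solutions are considered. *)
Definition mono_solutions (k : nat) (c : nat -> 'I_k)
    (E : nat -> nat -> nat -> Prop) : set (nat * nat * nat) :=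
  [set s | let: (x, y, z) := s in
    [/\ (0 < x)%N /\ (0 < y)%N /\ (0 < z)%N, E x y z, c x = c y & c y = c z]].

(* Meaningful for 0 < k only: there is no map nat -> 'I_0. *)
Definition Ramsey (k : nat) (E : nat -> nat -> nat -> Prop) : Prop :=
  forall c : nat -> 'I_k, infinite_set (mono_solutions c E).

(* Main.v *)
(* Suppose that no solution with [z >= N] is monochromatic, and put
   [F s := a ^ (n - 1) * s ^ n], so that [(a * s) ^ n = a * F s]. If [a * s] has
   colour r and [a * s'] the other one, then x |-> (a * s) ^ n - a * x sends
   colour r to the other colour, and back through s'; hence colour r is closed
   under x |-> x + (F s' - F s) as long as x < F s.
   If among the multiples of [a] in a window that is short relative to its
   position the colours follow a pattern r, r', r with r' <> r, there are both
   upward and downward such moves, and a rotation argument turns them into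
   periods of the colouring on [1, F u), where [a * u] is the start of the
   window. The n-th finite difference of [F] shows that the constant
   P = a ^ (n - 1) * n! is a period too, and a monochromatic solution exists
   among the multiples of P.
   So there is no such pattern. Take a late switch [a * s], [a * s.+1] of
   colour. The moves put the progression [a * s + k * (F s.+1 - F s)] in the
   colour of [a * s], and, its step being short, the multiples of [a] between
   its large terms have that colour as well. This yields [x] and [y] of the
   colour of [a * s] with [a * x + y = (a * s) ^ n]. *)
Require Import Defs.
From mathcomp Require Import all_boot.
From mathcomp Require Import all_algebra zify.
From mathcomp Require Import boolp classical_sets cardinality.

Set Implicit Arguments.
Unset Strict Implicit.
Unset Printing Implicit Defensive.

(** * Basic notions and scaled powers *)

Definition mono_free (a n N : nat) (col : nat -> bool) : Prop :=
  forall x y z, 0 < x -> 0 < y -> N <= z -> a * x + y = z ^ n ->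
    col x = col y -> col y = col z -> False.

(** The function called [F] in the overview. *)
Definition scaled_pow (a n s : nat) : nat := a ^ n.-1 * s ^ n.

Definition fdiff (h : nat -> int) (i : nat) : int := (h i.+1 - h i)%R.

Definition is_period (col : nat -> bool) (M : nat) (p : int) : Prop :=
  forall x y : nat, 0 < x <= M -> 0 < y <= M -> (y%:Z = x%:Z + p)%R ->
    col x = col y.

Lemma expn_scaled_pow a n s : 0 < n -> (a * s) ^ n = a * scaled_pow a n s.
Proof. by case: n => // n _; rewrite /scaled_pow mulnA -expnS expnMn. Qed.

Lemma scaled_pow_mono a n s t : s <= t -> scaled_pow a n s <= scaled_pow a n t.
Proof. by move=> st; rewrite leq_mul //; case: n => // n; rewrite leq_exp2r. Qed.

Lemma scaled_pow_ltn a n s t : 0 < a -> 0 < n -> s < t ->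
  scaled_pow a n s < scaled_pow a n t.
Proof. by move=> a0 n0 st; rewrite ltn_pmul2l ?expn_gt0 ?a0 // ltn_exp2r. Qed.

(** * Rotations and periods on an initial segment *)

(** Modulo [d1 + d2], adding [d1] and subtracting [d2] are the same rotation, and in a window of
    [d1 + d2] consecutive integers exactly one of them stays inside. Iterating it leads from
    [x + d1] back to [x]. *)
Lemma rotation_periodic (A : pred nat) (M d1 d2 : nat) :
    0 < d1 -> 0 < d2 -> d1 + d2 <= M ->
    (forall x, 0 < x -> x + d1 <= M -> A x -> A (x + d1)) ->
    (forall x, 0 < x -> x + d2 <= M -> A (x + d2) -> A x) ->
  forall x, 0 < x -> x + d1 <= M -> A (x + d1) = A x.
Proof.
move=> d1_gt0 d2_gt0 leM up down x x_gt0 lexM.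
set L := d1 + d2 in leM.
have L_gt0 : 0 < L by rewrite /L; lia.
have orbit b j k : 0 < b -> b + L <= M.+1 -> j < L -> A (b + j) ->
    A (b + (j + k * d1) %% L).
  move=> b_gt0 lebM jL Aj; elim: k => [|k IHk].
    by rewrite mul0n addn0 modn_small.
  rewrite mulSnr addnA -modnDml; move: IHk.
  have := ltn_pmod (j + k * d1) L_gt0; move: (_ %% L) => i iL Ai.
  case: (ltnP i d2) => [id2|d2i].
    rewrite modn_small; last by rewrite /L; lia.
    by rewrite addnA; apply: up => //; rewrite /L in lebM; lia.
  have -> : i + d1 = L + (i - d2) by rewrite /L; lia.
  rewrite modnDl modn_small; last by lia.
  by apply: down; [lia|lia|rewrite -addnA subnK].
apply/idP/idP => [Ax|]; last exact: up.
(* The window of length [L] from [b] lies in [[1, M]] and contains [x] and [x + d1]; [L.-1] further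
   rotations complete a full turn. *)
pose b := minn x (M.+1 - L).
have bx : b <= x by exact: geq_minl.
have b_gt0 : 0 < b by rewrite /b; lia.
have := @orbit b (x - b + d1) L.-1 b_gt0.
have -> : x - b + d1 + L.-1 * d1 = d1 * L + (x - b) by nia.
rewrite modnMDl modn_small; last by rewrite /b /L; lia.
rewrite addnA !subnKC //; apply => //.
  by rewrite /b; lia.
by rewrite /b /L; lia.
Qed.

Lemma is_periodN col M p : is_period col M p -> is_period col M (- p)%R.
Proof. by move=> per x y xM yM e; apply/esym/per => //; lia. Qed.

(** If [x + p] leaves [[1, M]], the size bound keeps [x + q] inside, so the two steps can be taken
    in the other order. *)
Lemma is_periodD col M p q : (`|p| + `|q| <= M)%N ->
  is_period col M p -> is_period col M q -> is_period col M (p + q)%R.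
Proof.
move=> le perp perq x y xM yM e.
case: (boolP ((0 < x%:Z + p) && (x%:Z + p <= M%:Z))%R) => xp.
  have xpE : ((absz (x%:Z + p))%:Z = x%:Z + p)%R by lia.
  by rewrite (perp _ (absz (x%:Z + p)%R)) ?(perq _ y) //; lia.
have xqE : ((absz (x%:Z + q))%:Z = x%:Z + q)%R by lia.
by rewrite (perq _ (absz (x%:Z + q)%R)) ?(perp _ y) //; lia.
Qed.

Lemma is_period_mul col M P k : is_period col M P%:Z ->
  0 < P -> 0 < k -> k * P <= M -> col (k * P) = col P.
Proof.
move=> per P0; elim: k => // -[|k] IHk _ le; first by rewrite mul1n.
rewrite -IHk //; last by nia.
by symmetry; apply: per; nia.
Qed.

(** * Finite differences of powers *)

(* A form of the Leibniz rule for the product of [h] with the identity. *)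
Lemma fdiff_mul_id h k i :
  (iter k fdiff (fun j => j%:Z * h j) i =
   i%:Z * iter k fdiff h i + k%:Z * iter k.-1 fdiff h i.+1)%R.
Proof.
elim: k i => [|k IHk] i; first by rewrite /= GRing.mul0r GRing.addr0.
rewrite iterS {1}/fdiff !IHk.
case: k {IHk} => [|k] /=; rewrite /fdiff; lia.
Qed.

Lemma eq_iter_fdiff h1 h2 k : h1 =1 h2 -> iter k fdiff h1 =1 iter k fdiff h2.
Proof. by move=> eqh; elim: k => [|k IHk] i //=; rewrite /fdiff !IHk. Qed.

Lemma iter_fdiff_affine h (A c : int) s k i :
  (iter k fdiff (fun j => A * h (s + j)%N - c) i =
   A * iter k fdiff h (s + i)%N - (k == 0)%:Z * c)%R.
Proof.
elim: k i => [|k IHk] i; first by rewrite /= GRing.mul1r.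
rewrite iterS {1}/fdiff !IHk addnS /= /fdiff; lia.
Qed.

Lemma iter_fdiff_exp n i : (iter n fdiff (fun j => (j ^ n)%N%:Z) i = n`!%:Z)%R.
Proof.
elim: n i => [|n IHn] i //.
have /eq_iter_fdiff-> : (fun j => (j ^ n.+1)%N%:Z)%R =1
    (fun j => j%:Z * (j ^ n)%N%:Z)%R by move=> j; rewrite expnS.
rewrite fdiff_mul_id iterS {1}/fdiff !IHn factS /=; lia.
Qed.

(** * Moves preserving a colour *)

(* The number [z' ^ n - a * x' = z ^ n - a * x] must be coloured differently
   from [z], hence like [z']. *)
Lemma mono_free_move a n N col z z' x x' : mono_free a n N col ->
  N <= z -> N <= z' -> col z != col z' -> 0 < x -> 0 < x' ->
  a * x < z ^ n -> a * x' + z ^ n = a * x + z' ^ n ->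
  col x = col z -> col x' = col z.
Proof.
move=> free Nz Nz' zz' x0 x'0 lt e xz.
have y0 : 0 < z ^ n - a * x by lia.
have e1 : a * x + (z ^ n - a * x) = z ^ n by lia.
have e2 : a * x' + (z ^ n - a * x) = z' ^ n by lia.
have h1 := free _ _ _ x0 y0 Nz e1.
have h2 := free _ _ _ x'0 y0 Nz' e2.
move: zz' xz h1 h2.
by case: (col z); case: (col z'); case: (col x); case: (col x');
  case: (col _) => // _ _ h1 h2;
  (case: (h1 erefl erefl) || case: (h2 erefl erefl)).
Qed.

Lemma scaled_shift a n N col u s1 s2 x x' : mono_free a n N col ->
  0 < a -> 0 < n -> N <= a * u -> u <= s1 -> u <= s2 ->
  col (a * s1) != col (a * s2) -> 0 < x < scaled_pow a n u -> 0 < x' ->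
  x' + scaled_pow a n s1 = x + scaled_pow a n s2 ->
  col x = col (a * s1) -> col x' = col (a * s1).
Proof.
move=> free a0 n0 Nu us1 us2 ne /andP[x0 xu] x'0 e.
have le1 : a * u <= a * s1 by rewrite leq_mul2l us1 orbT.
have le2 : a * u <= a * s2 by rewrite leq_mul2l us2 orbT.
have le3 := scaled_pow_mono a n us1.
apply: (mono_free_move free _ _ ne x0 x'0); [lia|lia| |].
  by rewrite expn_scaled_pow // ltn_pmul2l //; lia.
by rewrite !expn_scaled_pow // -!mulnDr e.
Qed.

(** * Periods forced by a dichromatic triple *)

Definition dichromatic_triple (a : nat) (col : nat -> bool) (u y t : nat) :=
  [/\ u < y, y < t, col (a * u) = col (a * t) & col (a * y) != col (a * u)].

(** The pair [s1], [s2] moves the colour of [a * s1] upward. The triple supplies a pair [s3 < s4]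
    moving the same colour downward: [y], [t] or [u], [y]. The rotation argument then applies. *)
Lemma opposite_period a n N col u y t e M s1 s2 : mono_free a n N col ->
  0 < a -> 0 < n -> N <= a * u -> dichromatic_triple a col u y t -> t <= e ->
  2 * (scaled_pow a n e - scaled_pow a n u) <= M -> M < scaled_pow a n u ->
  u <= s1 -> s1 < s2 -> s2 <= e -> col (a * s1) != col (a * s2) ->
  is_period col M ((scaled_pow a n s2)%:Z - (scaled_pow a n s1)%:Z)%R.
Proof.
move=> free a0 n0 Nu [uy yt ut yu] te leM Mu us1 s12 s2e ne.
have [s3 [s4 [us3 s34 s4e c4 c34]]] : exists s3 s4, [/\ u <= s3, s3 < s4, s4 <= e,
    col (a * s4) = col (a * s1) & col (a * s4) != col (a * s3)].
  case: (eqVneq (col (a * s1)) (col (a * u))) => c.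
    by exists y, t; split; [lia|lia|lia|rewrite c|rewrite -ut eq_sym].
  exists u, y; split; [lia|lia|lia| |by []].
  by move: c yu; case: (col _); case: (col _); case: (col _).
have m1 := scaled_pow_mono a n us1; have m2 := scaled_pow_mono a n s2e.
have m3 := scaled_pow_mono a n us3; have m4 := scaled_pow_mono a n s4e.
have l12 := scaled_pow_ltn a0 n0 s12; have l34 := scaled_pow_ltn a0 n0 s34.
set d1 := scaled_pow a n s2 - scaled_pow a n s1.
set d2 := scaled_pow a n s4 - scaled_pow a n s3.
have key x : 0 < x -> x + d1 <= M ->
    (col (x + d1) == col (a * s1)) = (col x == col (a * s1)).
  move=> x0 xM.
  apply: (@rotation_periodic (fun x => col x == col (a * s1)) M d1 d2) => //.
  - by rewrite subn_gt0.
  - by rewrite subn_gt0.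
  - by rewrite /d1 /d2; lia.
  - move=> {x0 xM}x x0 xM /eqP cx; apply/eqP.
    by apply: (@scaled_shift _ _ _ _ u s1 s2 x _ free) => //;
      rewrite /d1; lia.
  - move=> {x0 xM}x x0 xM /eqP; rewrite -c4 => cx; apply/eqP.
    by apply: (@scaled_shift _ _ _ _ u s4 s3 (x + d2) _ free) => //;
      rewrite /d2; lia.
move=> x x' xM x'M exx'; have -> : x' = x + d1 by rewrite /d1; lia.
have := key x; rewrite /d1 in exx' *.
move=> /(_ ltac:(lia) ltac:(lia)).
by case: (col x); case: (col (x + _)); case: (col _).
Qed.

(** Differences of [scaled_pow] from its value at [u] are periods, passing through [y] when the
    colours agree. Iterated differences of these remain periods, and the [n]-th one is constant. *)
Lemma window_period a n N col u y t M : mono_free a n N col ->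
  0 < a -> 0 < n -> N <= a * u -> dichromatic_triple a col u y t ->
  u + n <= t -> 2 ^ n * (scaled_pow a n t - scaled_pow a n u) <= M ->
  M < scaled_pow a n u -> is_period col M (a ^ n.-1 * n`!)%N%:Z%R.
Proof.
move=> free a0 n0 Nu tri unt leM Mu.
set E := scaled_pow a n t - scaled_pow a n u in leM *.
have n1 : 2 <= 2 ^ n by rewrite -{1}(expn1 2) leq_exp2l.
have leE : 2 * E <= M by apply: leq_trans leM; rewrite leq_mul2r n1 orbT.
have opp s1 s2 : u <= s1 -> s1 < s2 -> s2 <= t -> col (a * s1) != col (a * s2) ->
    is_period col M ((scaled_pow a n s2)%:Z - (scaled_pow a n s1)%:Z)%R.
  exact: (opposite_period free a0 n0 Nu tri (leqnn t) leE Mu).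
case: (tri) => uy yt ut yu.
have dist s : u <= s -> s <= t ->
    scaled_pow a n u <= scaled_pow a n s <= scaled_pow a n t.
  by move=> us st; rewrite !scaled_pow_mono.
have y_u : is_period col M ((scaled_pow a n y)%:Z - (scaled_pow a n u)%:Z)%R.
  by apply: opp => //; [lia|rewrite eq_sym].
have s_u s : u <= s -> s <= t ->
    is_period col M ((scaled_pow a n s)%:Z - (scaled_pow a n u)%:Z)%R.
  move=> us st; have bs := dist s us st; have by_ := dist y (ltnW uy) (ltnW yt).
  case: (eqVneq (col (a * s)) (col (a * u))) => [c|c]; last first.
    have us' : u < s.
      by rewrite ltn_neqAle us andbT; apply: contraNneq c => ->.
    by apply: opp => //; rewrite eq_sym.
  have cy : col (a * s) != col (a * y) by rewrite c eq_sym.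
  have [sy|ys|->] := ltngtP s y; last exact: y_u.
    have per := is_periodN (opp s y us sy (ltnW yt) cy).
    have -> : ((scaled_pow a n s)%:Z - (scaled_pow a n u)%:Z =
      ((scaled_pow a n y)%:Z - (scaled_pow a n u)%:Z) +
      - ((scaled_pow a n y)%:Z - (scaled_pow a n s)%:Z))%R by lia.
    by apply: is_periodD => //; rewrite /E in leE; lia.
  have per : is_period col M ((scaled_pow a n s)%:Z - (scaled_pow a n y)%:Z)%R.
    by apply: opp => //; [lia|rewrite eq_sym].
  have -> : ((scaled_pow a n s)%:Z - (scaled_pow a n u)%:Z =
    ((scaled_pow a n y)%:Z - (scaled_pow a n u)%:Z) +
    ((scaled_pow a n s)%:Z - (scaled_pow a n y)%:Z))%R by lia.
  by apply: is_periodD => //; rewrite /E in leE; lia.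
pose g j : int := ((a ^ n.-1)%N%:Z * ((u + j) ^ n)%N%:Z - (scaled_pow a n u)%:Z)%R.
have gE j : g j = ((scaled_pow a n (u + j))%:Z - (scaled_pow a n u)%:Z)%R by [].
(* The size bound doubles with each difference; [is_periodD] needs it to stay within [M]. *)
have main k i : i + k <= n ->
    is_period col M (iter k fdiff g i) /\ absz (iter k fdiff g i) <= 2 ^ k * E.
  elim: k i => [|k IHk] i ikn.
    have := dist (u + i) ltac:(lia) ltac:(lia).
    by rewrite /= gE => ?; split; [apply: s_u; lia|rewrite /E; lia].
  have [p1 b1] := IHk i.+1 ltac:(lia); have [p2 b2] := IHk i ltac:(lia).
  have lek : 2 ^ k.+1 * E <= M.
    by apply: leq_trans leM; rewrite leq_mul2r leq_exp2l //; apply/orP; right; lia.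
  rewrite iterS {1 3}/fdiff; move: lek b1 b2 p1 p2; rewrite expnS -mulnA.
  move: (2 ^ k * E) (iter k fdiff g i.+1) (iter k fdiff g i) => b q1 q2.
  move=> lek b1 b2 p1 p2.
  by split; [apply: is_periodD; [lia|by []|exact: is_periodN]|lia].
have [per _] := main n 0 (leqnn n); move: per.
rewrite (iter_fdiff_affine (fun j => (j ^ n)%N%:Z)%R) iter_fdiff_exp.
by rewrite (negbTE (lt0n_neq0 n0)) GRing.mul0r GRing.subr0.
Qed.

Lemma no_dichromatic_triple a n N col u y t : mono_free a n N col ->
  0 < a -> 0 < n -> a ^ n.-1 * n`! * (N + a).+1 < u -> u + n <= t ->
  2 ^ n * (scaled_pow a n t - scaled_pow a n u) < scaled_pow a n u ->
  ~ dichromatic_triple a col u y t.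
Proof.
move=> free a0 n0; set P := _ * n`! => Pu unt lt tri.
have P0 : 0 < P by rewrite muln_gt0 expn_gt0 a0 fact_gt0.
have Nu : N <= a * u by nia.
have per := @window_period _ _ _ _ _ _ _ (scaled_pow a n u).-1 free a0 n0 Nu tri unt
  ltac:(lia) ltac:(lia).
(* The solution is [P], [w ^ n - a * P], [w], all multiples of the period [P]; this [k] makes [w] at
   least [N] and the middle entry positive. *)
set k := (N + a).+1 in Pu; set w := k * P.
have w0 : 0 < w by rewrite muln_gt0.
have wM : w ^ n < scaled_pow a n u.
  apply: (@leq_trans (u ^ n)); first by rewrite ltn_exp2r // /w mulnC.
  by rewrite /scaled_pow leq_pmull // expn_gt0 a0.
have ww : w <= w ^ n by rewrite -{1}(expn1 w) leq_pexp2l.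
have wn : w ^ n = (k * w ^ n.-1) * P.
  by rewrite -{1}(prednK n0) expnS {1}/w mulnAC.
have ak : a < k * w ^ n.-1.
  apply: (@leq_trans k); first by rewrite /k; lia.
  by rewrite leq_pmulr // expn_gt0 w0.
have col_mul j : 0 < j -> j * P <= (scaled_pow a n u).-1 -> col (j * P) = col P.
  by move=> j0 jM; apply: (is_period_mul per).
have e : a * P + (k * w ^ n.-1 - a) * P = w ^ n.
  by rewrite -mulnDl subnKC // ltnW.
apply: (free P ((k * w ^ n.-1 - a) * P) w P0 _ _ e).
- by rewrite muln_gt0 subn_gt0 ak.
- by rewrite /w /k; nia.
- by rewrite col_mul //; [rewrite subn_gt0|lia].
- by rewrite !col_mul //; [lia|rewrite subn_gt0|lia].
Qed.

(** * Growth estimates *)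

Lemma expn_increment n s d : (s + d) ^ n <= s ^ n + d * n * (s + d) ^ n.-1.
Proof.
elim: n => [|[|n] IHn] //; first by rewrite !expn1 muln1 expn0 muln1.
rewrite (expnS _ n.+1) (expnS s) /=.
have le : s ^ n.+1 <= (s + d) ^ n.+1 by rewrite leq_exp2r // leq_addr.
have e : (s + d) ^ n.+1 = (s + d) * (s + d) ^ n by rewrite expnS.
move: IHn le e; rewrite [n.+1.-1]/=.
move: ((s + d) ^ n.+1) ((s + d) ^ n) (s ^ n.+1) => p q r IHn le e.
have -> : d * n.+2 * p = d * p + (s + d) * (d * n.+1 * q) by rewrite e; lia.
nia.
Qed.

Lemma scaled_pow_increment a n K s d : 0 < a -> 0 < n -> 0 < K ->
  K * n * 2 ^ n.-1 * d < s ->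
  K * (scaled_pow a n (s + d) - scaled_pow a n s) < scaled_pow a n s.
Proof.
move=> a0 n0 K0 lt; rewrite /scaled_pow -mulnBr mulnCA ltn_pmul2l ?expn_gt0 ?a0 //.
have ds : d <= s.
  apply: leq_trans (ltnW lt); apply: leq_pmull.
  by rewrite !muln_gt0 K0 n0 expn_gt0.
have := expn_increment n s d.
have : (s + d) ^ n.-1 <= 2 ^ n.-1 * s ^ n.-1.
  rewrite -expnMn; case: n.-1 => // m; rewrite leq_exp2r //; lia.
have := expnS s n.-1; rewrite (prednK n0) => ->.
have : 0 < s ^ n.-1 by rewrite expn_gt0; apply/orP; left; lia.
move: lt; move: ((s + d) ^ n) ((s + d) ^ n.-1) (s ^ n.-1) (2 ^ n.-1).
move=> p q r b lt r0 qb le.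
have h : K * (d * n * q) <= K * n * b * d * r.
  have := leq_mul (leqnn (K * d * n)) qb; lia.
have h2 : K * n * b * d * r < s * r by rewrite ltn_pmul2r.
apply: leq_ltn_trans h2; apply: leq_trans h.
by rewrite leq_mul2l; apply/orP; right; lia.
Qed.

Lemma square_le_pow a n s : 0 < a -> 1 < n -> s ^ 2 <= a ^ n.-2 * s ^ n.
Proof.
move=> a0 n1; case: s => [|s]; first by rewrite exp0n.
apply: (@leq_trans (s.+1 ^ n)); first by rewrite leq_pexp2l.
by rewrite leq_pmull // expn_gt0 a0.
Qed.

Lemma scaled_powE a n s : 1 < n -> scaled_pow a n s = a * (a ^ n.-2 * s ^ n).
Proof. by case: n => [|[|n]] // _; rewrite /scaled_pow mulnA -expnS. Qed.

(** * A late switch of colour and the final contradiction *)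

(** Otherwise all large multiples of [a] share a colour, and [(a * (2 * T)) ^ n] splits among them
    with [x = a * T]. *)
Lemma ex_switch a n N col S : mono_free a n N col -> 0 < a -> 1 < n ->
  exists2 s, S <= s & col (a * s) != col (a * s.+1).
Proof.
move=> free a0 n1; apply: contrapT => no.
set T := (S + N).+1.
have const i : col (a * (T + i)) = col (a * T).
  elim: i => [|i <-]; first by rewrite addn0.
  case: (eqVneq (col (a * (T + i))) (col (a * (T + i).+1))) => [->|ne].
    by rewrite addnS.
  by case: no; exists (T + i) => //; rewrite /T; lia.
have const' j : T <= j -> col (a * j) = col (a * T) by move=> /subnKC <-.
set k := 2 * T.
have le := square_le_pow k a0 n1.
have kT : T + a * T <= a * (a ^ n.-2 * k ^ n).
  apply: leq_trans (leq_mul (leqnn a) le); rewrite /k; nia.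
have Tk : T <= k by rewrite leq_pmull.
have kT' : T <= a * (a ^ n.-2 * k ^ n) - a * T by rewrite leq_subRL; lia.
have e : a * (a * T) + a * (a * (a ^ n.-2 * k ^ n) - a * T) = (a * k) ^ n.
  rewrite (expn_scaled_pow a k (ltnW n1)) (scaled_powE a k n1) -mulnDr subnKC //.
  exact: leq_trans (leq_addl _ _) kT.
apply: (free _ _ _ _ _ _ e).
- by rewrite muln_gt0 a0.
- by rewrite muln_gt0 a0; apply: leq_trans kT'.
- by apply: leq_trans (leq_pmull k a0); lia.
- by rewrite const'.
- by rewrite !const'.
Qed.

Lemma ex_arith_prog s d b : 0 < d -> s <= b ->
  exists2 j, s + j * d <= b & b < s + j.+1 * d.
Proof.
move=> d0 sb; exists ((b - s) %/ d).
  by have := leq_divM (b - s) d; lia.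
by have := ltn_ceil (b - s) d0; lia.
Qed.

(* With [u = s + k * d] and [q = a * (G - u)], both close to a fixed fraction
   of [G], the numbers [x = a * u], [y = a * q] satisfy [a * x + y = a ^ 2 * G]. *)
Lemma ex_split a C s d G : 0 < a -> 0 < C -> 0 < d -> 4 <= s -> s ^ 2 <= G ->
    (4 * C.+1 + 4 * a) * d < G ->
  exists k j, let q := a * (G - (s + k * d)) in
    [/\ s + k * d <= G, s + j * d <= q, q < s + j.+1 * d, s + j.+1 * d <= G
      & C * d < s + j * d].
Proof.
move=> a0 C0 d0 s4 sG; rewrite mulnDl => dG.
have sG' : 4 * s <= G by nia.
(* This cut puts [q] between [G / 4] and [G / 4 + a * d]: above [C * d], with room for one more term
   below [G]. *)
have [k] : exists2 k, s + k * d <= ((4 * a).-1 * G) %/ (4 * a) &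
    ((4 * a).-1 * G) %/ (4 * a) < s + k.+1 * d.
  apply: ex_arith_prog => //; rewrite leq_divRL ?muln_gt0 //.
  have := leq_mul (leqnn (4 * a).-1) sG'; nia.
rewrite leq_divRL ?ltn_divLR ?muln_gt0 // (mulSn k).
have [m mE] : exists m, 4 * a = m.+1 by exists (4 * a).-1; rewrite prednK // muln_gt0.
set u := s + k * d; have -> : s + (d + k * d) = u + d by rewrite /u; lia.
rewrite mE [m.+1.-1]/= => k1 k2; have uG : u <= G by nia.
have GE := subnKC uG; set v := G - u in GE *.
have q1 : G <= 4 * (a * v) by rewrite mulnA mE; nia.
have q2 : 4 * (a * v) < G + m.+1 * d by rewrite mulnA mE; nia.
have [j j1 j2] : exists2 j, s + j * d <= a * v & a * v < s + j.+1 * d.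
  by apply: ex_arith_prog => //; lia.
exists k, j; split => //; rewrite (mulSn j) in j2 *; rewrite mE in dG; lia.
Qed.

Lemma not_mono_free a n N col : 0 < a -> 1 < n -> ~ mono_free a n N col.
Proof.
move=> a0 n1 free; have n0 : 0 < n by lia.
(* [C] makes a window of length [d] starting beyond [C * d] short enough to exclude triples; [K] is
   the constant required by [ex_split]. *)
set C := 2 ^ n * n * 2 ^ n.-1; set K := 4 * C.+1 + 4 * a.
set T0 := a ^ n.-1 * n`! * (N + a).+1.
have C0 : 0 < C by rewrite !muln_gt0 n0 !expn_gt0.
have [s les ne] := ex_switch (T0 + n + 4 + N + (K * n * 2 ^ n.-1).+1) free a0 n1.
have Ks : K * (scaled_pow a n (s + 1) - scaled_pow a n s) < scaled_pow a n s.
  apply: scaled_pow_increment => //; rewrite muln1.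
  by apply: leq_trans les; exact: leq_addl.
have s0 : 0 < s by lia.
have Ns : N <= a * s by apply: leq_trans (leq_pmull s a0); lia.
set G := a ^ n.-2 * s ^ n.
set d := a ^ n.-2 * s.+1 ^ n - G.
have GE : scaled_pow a n s = a * G by rewrite scaled_powE.
have leGS : G + s <= a ^ n.-2 * s.+1 ^ n.
  have le1 : s * s ^ n.-1 + s ^ n.-1 <= s.+1 ^ n.
    have le0 : s ^ n.-1 <= s.+1 ^ n.-1 by case: n.-1 => // m; rewrite leq_exp2r.
    by rewrite -{3}(prednK n0) expnS mulSn addnC leq_add // leq_mul.
  have le2 : s <= s ^ n.-1.
    by rewrite -{1}(expn1 s) leq_pexp2l //; lia.
  have le3 : 0 < a ^ n.-2 by rewrite expn_gt0 a0.
  have sn : s ^ n = s * s ^ n.-1 by rewrite -expnS prednK.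
  rewrite /G sn.
  apply: leq_trans (leq_mul (leqnn _) le1); rewrite mulnDr leq_add2l.
  by apply: leq_trans le2 _; rewrite leq_pmull.
have ds : s <= d by rewrite /d; lia.
have SE : scaled_pow a n s.+1 = a * (G + d).
  by rewrite scaled_powE // /d subnKC //; lia.
have Kd : K * d < G.
  move: Ks; rewrite addn1 SE GE -mulnBr addKn mulnCA ltn_pmul2l //.
have sG : s ^ 2 <= G by exact: square_le_pow.
(* The switch moves numbers up by [a * d], hence cofactors of [a] by [d]. *)
have prog j : s + j * d <= G -> col (a * (s + j * d)) = col (a * s).
  elim: j => [|j IHj] le; first by rewrite mul0n addn0.
  have le' : s + j * d < G by move: le; rewrite mulSn; lia.
  apply: (@scaled_shift _ _ _ _ s s s.+1 (a * (s + j * d)) _ free) => //.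
  - by rewrite muln_gt0 a0 GE ltn_pmul2l // le' andbT; lia.
  - by rewrite muln_gt0 a0; lia.
  - by rewrite GE SE -!mulnDr mulSn; congr (_ * _); lia.
  - by apply: IHj; lia.
have s4 : 4 <= s by lia.
have [k [j []]] := ex_split a0 C0 (leq_trans s0 ds) s4 sG Kd.
set q := a * (G - _) => kG j1 j2 jG jC.
have q0 : 0 < q by apply: leq_trans j1; lia.
have jd : d < s + j * d by apply: leq_ltn_trans jC; rewrite leq_pmull.
have tE : s + j.+1 * d = s + j * d + d by rewrite mulSn; lia.
(* Otherwise [q] and the two terms around it form an excluded triple. *)
have col_q : col (a * q) = col (a * s).
  case: (eqVneq (col (a * q)) (col (a * s))) => // cq; exfalso.
  have qj : s + j * d < q.
    rewrite ltn_neqAle j1 andbT; apply: contraNneq cq => <-.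
    by rewrite prog //; lia.
  apply: (@no_dichromatic_triple _ _ _ _ (s + j * d) q (s + j.+1 * d) free a0 n0).
  - by rewrite -/T0; lia.
  - by rewrite tE; lia.
  - rewrite tE; apply: scaled_pow_increment => //.
    by rewrite expn_gt0.
  - by split => //; rewrite !prog //; lia.
have e : a * (a * (s + k * d)) + a * q = (a * s) ^ n.
  by rewrite expn_scaled_pow // GE /q -!mulnDr subnKC.
apply: (free _ _ _ _ _ Ns e).
- by rewrite muln_gt0 a0 addn_gt0 s0.
- by rewrite muln_gt0 a0 q0.
- by rewrite prog // col_q.
- by rewrite col_q.
Qed.

Theorem theorem1p2 (a n : nat) (ha : (0 < a)%N) (hn : (2 <= n)%N) :
  Ramsey 2 (fun x y z : nat => (a * x + y)%N = (z ^ n)%N).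
Proof.
move=> c /finite_seqP[s sE].
have ord2 (i j : 'I_2) : (i == ord0) = (j == ord0) -> i = j.
  by move: i j => [[|[|i]] ?] [[|[|j]] ?] //= _; apply/val_inj.
(* The bound exceeds the [z] of each of the finitely many solutions. *)
apply: (@not_mono_free a n (\max_(p <- s) p.2).+1 (fun x => c x == ord0) ha hn).
move=> x y z x0 y0 zs e /ord2 cxy /ord2 cyz.
have z0 : 0 < z by apply: leq_trans zs.
have : mono_solutions c (fun x y z => a * x + y = z ^ n) (x, y, z) by split.
rewrite sE /= => /(@leq_bigmax_seq _ _ predT snd) /(_ isT) /=.
by rewrite leqNgt zs.
Qed.
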